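(* Let $G$ be a simple graph on $n$ vertices, and suppose $G$ has an induced (chordless) cycle of length at least $4$; let $m$ be the smallest length of such a cycle. A $G$-partial matrix $\pi_G(a_{ij})$ has a positive definite completion if and only if (a) every completely specified principal submatrix is positive definite, and (b) $\pi_G(a_{ij})$ can be completed to a positive semidefinite matrix of rank greater than $n-m+2$. If $G$ is chordal (has no induced cycle of length $\geq 4$), then a $G$-partial matrix has a positive definite completion if and only if (a) holds.
   Context: A $G$-partial matrix is the data $\pi_G(A)=((a_{ii})_{i\in[n]},(a_{ij})_{\{i,j\}\in E})$ of a real symmetric $n\times n$ matrix $A$ restricted to its diagonal and entries indexed by edges of $G=([n],E)$; a completion is any real symmetric matrix with these specified entries. The completely specified principal submatrices are the principal submatrices indexed by cliques of $G$. *)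

(* Defs.v *)
From HB Require Import structures.
From mathcomp Require Import all_boot all_order all_algebra.
Set Implicit Arguments. Unset Strict Implicit. Unset Printing Implicit Defensive.
Import Order.TTheory GRing.Theory Num.Theory.
Local Open Scope ring_scope.

Definition simple_graph (n : nat) (e : rel 'I_n) : Prop :=
  (forall i j, e i j = e j i) /\ (forall i, ~~ e i i).

Definition induced_cycle (n k : nat) (e : rel 'I_n) (f : 'I_k -> 'I_n) : Prop :=
  injective f /\
  forall i j : 'I_k,
    e (f i) (f j) = ((j %% k == (i + 1) %% k)%N || (i %% k == (j + 1) %% k)%N).

Definition has_induced_cycle (n k : nat) (e : rel 'I_n) : Prop :=
  exists f : 'I_k -> 'I_n, induced_cycle e f.

Definition chordal (n : nat) (e : rel 'I_n) : Prop :=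
  forall k, (4 <= k)%N -> ~ has_induced_cycle k e.

Definition clique (n : nat) (e : rel 'I_n) (S : {set 'I_n}) : Prop :=
  forall i j, i \in S -> j \in S -> i != j -> e i j.

Definition symmetric_mx (R : ringType) (n : nat) (A : 'M[R]_n) : Prop := A^T = A.

Definition pos_def (R : realFieldType) (n : nat) (A : 'M[R]_n) : Prop :=
  symmetric_mx A /\ forall x : 'cV[R]_n, x != 0 -> 0 < (x^T *m A *m x) 0 0.

Definition pos_semidef (R : realFieldType) (n : nat) (A : 'M[R]_n) : Prop :=
  symmetric_mx A /\ forall x : 'cV[R]_n, 0 <= (x^T *m A *m x) 0 0.

Definition principal_submx (R : Type) (n : nat) (A : 'M[R]_n) (S : {set 'I_n})
  : 'M[R]_#|S| := \matrix_(i, j) A (enum_val i) (enum_val j).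

Definition completion (R : ringType) (n : nat) (e : rel 'I_n) (A B : 'M[R]_n) : Prop :=
  symmetric_mx B /\ (forall i, B i i = A i i) /\ (forall i j, e i j -> B i j = A i j).

Definition cliques_pd (R : realFieldType) (n : nat) (e : rel 'I_n) (A : 'M[R]_n) : Prop :=
  forall S : {set 'I_n}, clique e S -> pos_def (principal_submx A S).

(* Main.v *)
Require Import Defs.
From HB Require Import structures.
From mathcomp Require Import all_boot all_order all_algebra.
From mathcomp Require Import zify ring lra.
Import Order.TTheory GRing.Theory Num.Theory.
Local Open Scope ring_scope.

Set Implicit Arguments.
Unset Strict Implicit.
Unset Printing Implicit Defensive.

(** A completion of [A] is [A] plus a matrix [Z] that vanishes on the diagonal
    and on the edges; call such a [Z] a nonedge matrix.

    Let [B] be a positive semidefinite completion with kernel [L] of dimension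
    [d].  By (a), no nonzero vector of [L] is supported on a clique.  If a nonedge
    matrix [Z] is positive definite on [L], then [B + s Z] is positive definite
    for small [s > 0].  Such a [Z] exists as soon as there is no induced cycle of
    length between [4] and [d + 2], by induction on [d].  It is enough to find a
    nonedge [Z1] that is semidefinite and nonzero on [L]: the induction
    hypothesis applies to the radical of [Z1] on [L], and one adds a large
    multiple of [Z1].  Take nonadjacent [v], [x] whose coordinates do not vanish
    on [L], and a minimal set [I] of non-neighbours of [v] whose coordinates
    determine on [L] those of all non-neighbours; unless [v] itself gives [Z1],
    [#|I| < d].  If, for a connected component [K] of [G[I]], some nonzero
    combination on [L] of the coordinates in [K] is also a combination of
    coordinates outside [K] and its neighbours, then the square of that linear
    form comes from a nonedge matrix.  Otherwise the coordinates in [I] can be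
    eliminated by a projection of [L] onto a smaller subspace [L'] of [L], which
    pulls nonedge matrices back to nonedge matrices: two nonadjacent neighbours
    of [v] attached to the same [K] would close up with [v] to an induced cycle
    of length at most [#|I| + 3].  The induction hypothesis for [L'] then
    provides [Z1].

    In the chordal case, two nonadjacent vertices are separated by a clique, and
    positive definite completions of the two sides, which agree on the clique,
    can be amalgamated. *)

(** * Quadratic forms *)

Section Forms.
Variable R : realFieldType.

Definition bform (d : nat) (M : 'M[R]_d) (y z : 'rV[R]_d) : R :=
  (y *m M *m z^T) 0 0.

Lemma bformDl d (M : 'M[R]_d) x y z :
  bform M (x + y) z = bform M x z + bform M y z.
Proof. by rewrite /bform !mulmxDl mxE. Qed.

Lemma bformDr d (M : 'M[R]_d) x y z :
  bform M x (y + z) = bform M x y + bform M x z.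
Proof. by rewrite /bform linearD /= mulmxDr mxE. Qed.

Lemma bformZl d (M : 'M[R]_d) a y z : bform M (a *: y) z = a * bform M y z.
Proof. by rewrite /bform -!scalemxAl mxE. Qed.

Lemma bformZr d (M : 'M[R]_d) a y z : bform M y (a *: z) = a * bform M y z.
Proof. by rewrite /bform linearZ /= -scalemxAr mxE. Qed.

Lemma bformDm d (M N : 'M[R]_d) y z :
  bform (M + N) y z = bform M y z + bform N y z.
Proof. by rewrite /bform mulmxDr mulmxDl mxE. Qed.

Lemma bformZm d a (M : 'M[R]_d) y z : bform (a *: M) y z = a * bform M y z.
Proof. by rewrite /bform -scalemxAr -scalemxAl mxE. Qed.

Lemma bformC d (M : 'M[R]_d) y z : M^T = M -> bform M y z = bform M z y.
Proof.
move=> sM; rewrite /bform -[in LHS](trmxK (y *m M *m z^T)) [LHS]mxE.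
by rewrite !trmx_mul trmxK sM mulmxA.
Qed.

Lemma bform_conj d1 d2 (V : 'M[R]_(d1, d2)) (M : 'M[R]_d2) y z :
  bform (V *m M *m V^T) y z = bform M (y *m V) (z *m V).
Proof. by rewrite /bform trmx_mul !mulmxA. Qed.

Lemma bformE d (M : 'M[R]_d) y z :
  bform M y z = \sum_i \sum_j y 0 i * M i j * z 0 j.
Proof.
rewrite /bform !mxE exchange_big /=; apply: eq_bigr => j _.
by rewrite !mxE mulr_suml; apply: eq_bigr => i _.
Qed.

Lemma bform0l d (M : 'M[R]_d) z : bform M 0 z = 0.
Proof. by rewrite /bform !mul0mx mxE. Qed.

Lemma bform_CauchySchwarz d (M : 'M[R]_d) y z :
  M^T = M -> (forall x, 0 <= bform M x x) ->
  bform M y z ^+ 2 <= bform M y y * bform M z z.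
Proof.
move=> sM pM.
have E a b : bform M (a *: y + b *: z) (a *: y + b *: z) =
    a ^+ 2 * bform M y y + 2 * a * b * bform M y z + b ^+ 2 * bform M z z.
  rewrite !bformDl !bformDr !bformZl !bformZr (bformC z y sM); ring.
have := pM y; have := pM z.
set p := bform M y y in E *; set q := bform M z z in E *.
set b := bform M y z in E * => q0 p0.
have [q00|qn0] := eqVneq q 0.
  have [->|bn0] := eqVneq b 0; first by rewrite q00 mulr0 expr0n.
  (* With [q = 0] and [b] nonzero this vector would have the negative value [- p - 2]. *)
  have := pM (1 *: y + (- (p + 1) / b) *: z); rewrite E q00.
  have -> : 1 ^+ 2 * p + 2 * 1 * (- (p + 1) / b) * b + (- (p + 1) / b) ^+ 2 * 0
          = - p - 2 by field.
  lra.
have qp : 0 < q by rewrite lt_def qn0.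
have := pM (q *: y + (- b) *: z); rewrite E.
have -> : q ^+ 2 * p + 2 * q * - b * b + (- b) ^+ 2 * q = q * (p * q - b ^+ 2).
  ring.
by rewrite pmulr_rge0 // subr_ge0.
Qed.

Lemma bform_isotropic d (M : 'M[R]_d) z :
  M^T = M -> (forall x, 0 <= bform M x x) -> bform M z z = 0 -> z *m M = 0.
Proof.
move=> sM pM z0; apply/rowP => j; rewrite [RHS]mxE.
have := bform_CauchySchwarz z (delta_mx 0 j) sM pM.
rewrite z0 mul0r => h; have : bform M z (delta_mx 0 j) = 0.
  by apply/eqP; rewrite -sqrf_eq0 eq_le h sqr_ge0.
by rewrite /bform trmx_delta -colE mxE.
Qed.

Lemma definite_add_multiple d (P0 P1 : 'M[R]_d) :
  P0^T = P0 -> P1^T = P1 -> (forall y, 0 <= bform P1 y y) ->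
  (forall y, y *m P1 = 0 -> y != 0 -> 0 < bform P0 y y) ->
  exists2 t, 0 < t & forall y, y != 0 -> 0 < bform (P0 + t *: P1) y y.
Proof.
move=> s0 s1 pos1 pos0.
(* Split [z] along the kernel of [P1] and its [P0]-orthogonal complement; on the
   latter the coordinates, hence [P0], are bounded by [P1] (Cauchy-Schwarz). *)
pose N := row_base (kermx P1).
have fN : row_free N := row_base_free _.
have NP1 (y : 'rV_(\rank (kermx P1))) : y *m N *m P1 = 0.
  apply/sub_kermxP; apply: submx_trans (submxMl _ _) _.
  by rewrite eq_row_base.
have kerN (y : 'rV_d) : y *m P1 = 0 -> exists a, y = a *m N.
  by move=> /sub_kermxP yk; apply/submxP; rewrite eq_row_base.
(* The Gram matrix of [P0] on the kernel of [P1], invertible because [P0] is definite there. *)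
pose C := N *m P0 *m N^T.
have uC : C \in unitmx.
  rewrite -row_free_unit -kermx_eq0; apply/eqP/row_matrixP => i.
  set y := row i _; rewrite row0.
  have yC : y *m C = 0 by apply/sub_kermxP/row_sub.
  apply/eqP; apply: contraT => yn0.
  have yN : y *m N != 0 by rewrite mulmx_free_eq0.
  have := pos0 _ (NP1 y) yN.
  by rewrite -bform_conj /bform yC mul0mx mxE ltxx.
(* A vector in the kernel of [P1] and [P0]-orthogonal to that kernel is zero, so [J] has a right
   inverse; its upper block [T] recovers [y] from [y *m P1] on the complement. *)
pose J := row_mx P1 (P0 *m N^T).
have fJ : row_free J.
  rewrite -kermx_eq0; apply/eqP/row_matrixP => i.
  set y := row i _; rewrite row0.
  have : y *m J = 0 by apply/sub_kermxP/row_sub.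
  rewrite mul_mx_row -[0]row_mx0 => /eq_row_mx [/kerN [a ya]].
  rewrite ya mulmxA => aC; apply/eqP; rewrite mulmx_free_eq0 //.
  rewrite -(mulmxK uC a) /C (mulmxA a) (mulmxA a) aC mul0mx //.
have [J' JJ'] := row_freeP fJ.
pose T := usubmx J'.
have TE (y : 'rV_d) : y *m P0 *m N^T = 0 -> y = y *m P1 *m T.
  move=> y0; rewrite -[LHS]mulmx1 -JJ' mulmxA mul_mx_row mulmxA y0.
  by rewrite -[J']vsubmxK mul_row_col mul0mx addr0.
pose tau i := (col i T)^T.
pose s := \sum_i bform P1 (tau i) (tau i).
have coord y i : y *m P0 *m N^T = 0 -> y 0 i ^+ 2 <= s * bform P1 y y.
  move=> y0; have -> : y 0 i = bform P1 y (tau i).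
    rewrite [in LHS](TE _ y0) /bform trmxK [LHS]mxE [RHS]mxE.
    by apply: eq_bigr => j _; rewrite [col i T _ _]mxE.
  apply: le_trans (bform_CauchySchwarz _ _ s1 pos1) _.
  rewrite mulrC ler_wpM2r // /s (bigD1 i) //= lerDl; exact: sumr_ge0.
pose c := \sum_i \sum_j `|P0 i j|.
have c0 : 0 <= c by do 2! apply: sumr_ge0 => ? _.
have s_ge0 : 0 <= s by apply: sumr_ge0.
have lower y : y *m P0 *m N^T = 0 -> - (s * c * bform P1 y y) <= bform P0 y y.
  move=> y0; rewrite lerNl bformE -sumrN /c mulr_sumr mulr_suml.
  apply: ler_sum => i _; rewrite -sumrN mulr_sumr mulr_suml; apply: ler_sum => j _.
  have h : `|y 0 i * y 0 j| <= s * bform P1 y y.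
    have := coord _ i y0; have := coord _ j y0; rewrite ler_norml; nra.
  have := ler_wpM2l (normr_ge0 (P0 i j)) h; rewrite -normrM => h'.
  apply: le_trans (ler_norm _) _; rewrite normrN.
  have -> : y 0 i * P0 i j * y 0 j = P0 i j * (y 0 i * y 0 j) by ring.
  apply: le_trans h' _; rewrite le_eqVlt; apply/orP; left; apply/eqP; ring.
(* On the complement [P0] is at least [- s * c] times [P1], so this multiple leaves at least one
   copy of [P1] there. *)
exists (1 + s * c); first by nra.
move=> z zn0.
pose z0 := z *m P0 *m N^T *m invmx C *m N.
pose z1 := z - z0.
have z1N : z1 *m P0 *m N^T = 0.
  rewrite /z1 !mulmxBl /z0.
  have -> : z *m P0 *m N^T *m invmx C *m N *m P0 *m N^T =
            z *m P0 *m N^T *m invmx C *m C by rewrite /C !mulmxA.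
  by rewrite mulmxKV // subrr.
have zE : z = z0 + z1 by rewrite /z1 addrC subrK.
have cross : bform P0 z1 z0 = 0.
  by rewrite /bform /z0 trmx_mul mulmxA z1N mul0mx mxE.
have z0P : z0 *m P1 = 0 by apply: NP1.
have -> : bform (P0 + (1 + s * c) *: P1) z z =
  bform P0 z0 z0 + (bform P0 z1 z1 + (1 + s * c) * bform P1 z1 z1).
  clearbody z1; rewrite bformDm bformZm {1 2}zE bformDl !bformDr cross.
  rewrite (bformC z0 z1 s0) cross.
  have -> : bform P1 z z = bform P1 z1 z1.
    have q0 y : bform P1 z0 y = 0 by rewrite /bform z0P mul0mx mxE.
    by rewrite zE bformDl !bformDr !q0 (bformC z1 z0 s1) q0; ring.
  ring.
have q0 : 0 <= bform P0 z0 z0.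
  have [->|z0n] := eqVneq z0 0; first by rewrite bform0l.
  exact/ltW/pos0.
have q1 := pos1 z1; have q2 := lower _ z1N.
have [e1|n1] := eqVneq (bform P1 z1 z1) 0; last first.
  have : 0 < bform P1 z1 z1 by rewrite lt_def n1.
  by move=> ?; nra.
have z10 : z1 = 0 by rewrite (TE _ z1N) (bform_isotropic s1 pos1 e1) mul0mx.
rewrite e1 z10 bform0l mulr0 !addr0; apply: pos0 => //.
by move: zn0; rewrite zE z10 addr0.
Qed.

End Forms.

(** * Induced cycles *)

Section Cycles.
Variables (n : nat) (e : rel 'I_n).
Hypotheses (esym : forall i j, e i j = e j i) (eirr : forall i, ~~ e i i).

(* [L] counts edges; the values of [f] beyond [L] are irrelevant. *)
Definition walk (I : {set 'I_n}) (a b : 'I_n) (L : nat) (f : nat -> 'I_n) :=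
  [/\ f 0%N = a, f L = b, (forall s, (0 < s < L)%N -> f s \in I)
    & (forall s, (s < L)%N -> e (f s) (f s.+1))].

(** A repeated vertex lets the stretch between [s] and [t] be cut out; a chord replaces that stretch
    by a single edge. *)
Lemma walk_shorten (I : {set 'I_n}) a b L f s t :
  walk I a b L f -> (s < t <= L)%N ->
  (f s == f t) || e (f s) (f t) && (s.+1 < t)%N ->
  exists2 L', (L' < L)%N & exists g, walk I a b L' g.
Proof.
move=> [f0 fL fI fe] /andP[st tL] /orP[/eqP E|/andP[E st1]].
- exists (L - (t - s))%N; first lia.
  exists (fun r => if (r <= s)%N then f r else f (r + (t - s))%N); split=> //.
  + case: leqP => h; last by rewrite -fL; congr f; lia.
    by have -> : (L - (t - s) = s)%N; [lia | rewrite E -fL; congr f; lia].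
  + by move=> r hr; case: leqP => h; apply: fI; lia.
  + move=> r hr; case: (leqP r s) => h; case: (leqP r.+1 s) => h'; try lia.
    * by apply: fe; lia.
    * have -> : r = s by lia.
      rewrite E; have -> : (s.+1 + (t - s) = t.+1)%N by lia.
      by apply: fe; lia.
    * by rewrite addSn; apply: fe; lia.
- exists (L - (t - s.+1))%N; first lia.
  exists (fun r => if (r <= s)%N then f r else f (r + (t - s.+1))%N); split=> //.
  + by case: leqP => h; [lia | rewrite -fL; congr f; lia].
  + by move=> r hr; case: leqP => h; apply: fI; lia.
  + move=> r hr; case: (leqP r s) => h; case: (leqP r.+1 s) => h'; try lia.
    * by apply: fe; lia.
    * have -> : r = s by lia.
      by have -> : (s.+1 + (t - s.+1) = t)%N by lia.
    * by rewrite addSn; apply: fe; lia.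
Qed.

(** Adding [v] closes the walk to a cycle with [L + 2] vertices. The [L - 1] inner vertices of the
    walk are distinct elements of [I], which bounds the length. *)
Lemma chordless_walk_cycle (I : {set 'I_n}) v a b L f :
  walk I a b L f -> (forall i, i \in I -> i != v /\ ~~ e v i) ->
  e v a -> e v b -> a != b -> ~~ e a b ->
  (forall s t, (s < t <= L)%N -> f s != f t) ->
  (forall s t, (s < t <= L)%N -> e (f s) (f t) = (t == s.+1)) ->
  exists k, [/\ (4 <= k)%N, (k <= #|I| + 3)%N & has_induced_cycle k e].
Proof.
move=> [f0 fL fI fe] Iv va vb ab nab finj fchord.
have L2 : (2 <= L)%N.
  case: L f0 fL fe {fI finj fchord} => [|[|L]] // f0 fL fe.
    by move: ab; rewrite -f0 -fL eqxx.
  by have := fe 0%N isT; rewrite f0 fL (negbTE nab).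
exists L.+2; split; first lia.
  have : injective (fun s : 'I_L.-1 => f s.+1).
    move=> s t E; apply: val_inj => /=.
    case: (ltngtP s t) => // h.
      have := ltn_ord t; have := finj s.+1 t.+1; rewrite E eqxx.
      by move=> hf hl; have := hf ltac:(lia).
    have := ltn_ord s; have := finj t.+1 s.+1; rewrite E eqxx.
    by move=> hf hl; have := hf ltac:(lia).
  move/card_imset => /(_ predT) cI.
  suff : (L.-1 <= #|I|)%N by lia.
  rewrite -[X in (X <= _)%N]card_ord -cI; apply/subset_leq_card/subsetP => y.
  by case/imsetP => s _ ->; apply: fI; have := ltn_ord s; lia.
have fv s : (s <= L)%N -> f s != v.
  move=> sL; have [->|s0] := eqVneq s 0%N.
    by rewrite f0; apply: contraTneq va => ->.
  have [->|sL'] := eqVneq s L.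
    by rewrite fL; apply: contraTneq vb => ->.
  by case: (Iv (f s)) => //; apply: fI; lia.
have ev s : (s <= L)%N -> e v (f s) = (s == 0%N) || (s == L).
  move=> sL; have [->|s0] := eqVneq s 0%N; first by rewrite f0 va.
  have [->|sL'] := eqVneq s L; first by rewrite fL vb.
  by case: (Iv (f s)) => [|_ /negbTE]//; apply: fI; lia.
exists (fun i : 'I_L.+2 => if nat_of_ord i is s.+1 then f s else v); split.
  case=> [[|s] hs] [[|t] ht] //= E; apply: val_inj => //=.
  - by have := fv t; rewrite -E eqxx => h; have := h ltac:(lia).
  - by have := fv s; rewrite E eqxx => h; have := h ltac:(lia).
  - case: (ltngtP s t) => [h|h|-> //].
      by have := finj s t ltac:(lia); rewrite E eqxx.
    by have := finj t s ltac:(lia); rewrite E eqxx.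
have modS r : (r < L.+2)%N -> ((r + 1) %% L.+2 = if r == L.+1 then 0 else r.+1)%N.
  move=> hr; case: eqP => [->|h]; first by rewrite addn1 modnn.
  by rewrite modn_small; lia.
have L1 : (0%N == L.+1) = false by [].
case=> [[|s] hs] [[|t] ht] /=; rewrite !modS // ?(modn_small hs) ?(modn_small ht) ?L1.
- by rewrite (negbTE (eirr v)) /=.
- rewrite ev; last lia.
  by case: (eqVneq t.+1 L.+1); lia.
- rewrite esym ev; last lia.
  by case: (eqVneq s.+1 L.+1); lia.
- case: (ltngtP s t) => h.
  + rewrite fchord; last lia.
    by case: (eqVneq s.+1 L.+1); case: (eqVneq t.+1 L.+1); lia.
  + rewrite esym fchord; last lia.
    by case: (eqVneq s.+1 L.+1); case: (eqVneq t.+1 L.+1); lia.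
  + rewrite h (negbTE (eirr _)).
    by case: (eqVneq t.+1 L.+1); lia.
Qed.

(** A walk of minimal length repeats no vertex and has no chord. *)
Lemma walk_cycle (I : {set 'I_n}) v a b L f :
  walk I a b L f -> (forall i, i \in I -> i != v /\ ~~ e v i) ->
  e v a -> e v b -> a != b -> ~~ e a b ->
  exists k, [/\ (4 <= k)%N, (k <= #|I| + 3)%N & has_induced_cycle k e].
Proof.
elim/ltn_ind: L f => L IH f wf Iv va vb ab nab.
pose bad (p : 'I_L.+1 * 'I_L.+1) :=
  (p.1 < p.2)%N && ((f p.1 == f p.2) || e (f p.1) (f p.2) && (p.1.+1 < p.2)%N).
have [/existsP[[s t] /andP[/= st h]]|/existsPn good] := boolP [exists p, bad p].
  have stL : (s < t <= L)%N by have := ltn_ord t; lia.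
  have [L' LL' [g wg]] := walk_shorten wf stL h.
  exact: (IH L' LL' g wg Iv va vb ab nab).
have {}good s t : (s < t <= L)%N ->
    (f s != f t) /\ (e (f s) (f t) -> t = s.+1).
  move=> /andP[st tL]; have hs : (s < L.+1)%N by lia.
  have ht : (t < L.+1)%N by lia.
  have := good (Ordinal hs, Ordinal ht); rewrite /bad /= st /= negb_or.
  by case/andP=> -> /nandP[/negbTE->//|h]; split=> // _; lia.
apply: (chordless_walk_cycle wf Iv va vb ab nab).
  by move=> s t /good[].
move=> s t st; apply/idP/eqP; first by have [_] := good _ _ st.
by move=> ->; case: wf => _ _ _; apply; lia.
Qed.

Definition within (I : {set 'I_n}) : rel 'I_n :=
  [rel x y | [&& x \in I, y \in I & e x y]].

Lemma connect_induced_cycle (I : {set 'I_n}) v a b i j :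
  (forall x, x \in I -> x != v /\ ~~ e v x) ->
  i \in I -> connect (within I) i j ->
  e v a -> e v b -> a != b -> ~~ e a b -> e a i -> e b j ->
  exists k, [/\ (4 <= k)%N, (k <= #|I| + 3)%N & has_induced_cycle k e].
Proof.
move=> Iv iI /connectP[p pp jE] va vb ab nab ai bj.
have pI : {in i :: p, forall x, x \in I}.
  move=> x; rewrite inE => /predU1P[-> //|].
  elim: p i iI pp {ai jE} => //= y p IHp i iI /andP[/and3P[_ yI _] pp].
  by rewrite inE => /predU1P[-> //|]; exact: IHp yI pp.
(* The list has [(size p).+2] entries, so the last vertex [b] of the walk is the default value of
   [nth]. *)
apply: (@walk_cycle I v a b (size p).+2 (nth b [:: a, i & p])) => //; split.
- by [].
- by rewrite nth_default.
- by case=> // s /= hs; apply: pI; apply: mem_nth.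
- case=> [|s] //= hs.
  have [sp|sp] := ltnP s (size p).
    by have /(pathP b)/(_ s sp)/and3P[] := pp.
  have -> : s = size p by apply/eqP; rewrite eqn_leq sp andbT.
  by rewrite [nth b p _]nth_default // (nth_last b (i :: p)) /= -jE esym.
Qed.

End Cycles.

(** * Nonedge matrices definite on a subspace *)

Section Masks.
Variables (R : realFieldType) (n : nat).

Definition mask_mx (T : {set 'I_n}) : 'M[R]_n := diag_mx (\row_l (l \in T)%:R).

Lemma mask_mul p (T : {set 'I_n}) (M : 'M[R]_(n, p)) i j :
  (mask_mx T *m M) i j = (i \in T)%:R * M i j.
Proof. by rewrite mul_diag_mx !mxE. Qed.

Lemma mul_mask p (T : {set 'I_n}) (M : 'M[R]_(p, n)) i j :
  (M *m mask_mx T) i j = M i j * (j \in T)%:R.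
Proof. by rewrite mul_mx_diag !mxE. Qed.

Lemma tr_mask (T : {set 'I_n}) : (mask_mx T)^T = mask_mx T.
Proof. exact: tr_diag_mx. Qed.

Lemma mul_mask_eq0 p (T : {set 'I_n}) (M : 'M[R]_(p, n)) :
  M *m mask_mx T = 0 <-> forall i j, j \in T -> M i j = 0.
Proof.
split=> [M0 i j jT|M0]; last first.
  by apply/matrixP => i j; rewrite mul_mask mxE; have [/M0->|_] := boolP (j \in T);
    rewrite ?mul0r ?mulr0.
by have /matrixP/(_ i j) := M0; rewrite mul_mask jT mulr1 mxE.
Qed.

(** Fredholm alternative for the columns of [V]: column [i] lies in the span of those indexed by
    [T], or some vector annihilates the latter but not column [i]. *)
Lemma coordinate_alternative d (V : 'M[R]_(d, n)) i (T : {set 'I_n}) :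
  (exists c : 'rV[R]_n, (forall l, l \notin T -> c 0 l = 0) /\
     (forall z : 'rV_n, (z <= V)%MS -> z 0 i = (z *m c^T) 0 0)) \/
  (exists g : 'rV[R]_n, [/\ (g <= V)%MS, g 0 i = 1
     & forall l, l \in T -> g 0 l = 0]).
Proof.
pose VT := V *m mask_mx T.
have [/submxP[D VD]|nsub] := boolP ((col i V)^T <= VT^T)%MS; [left|right].
  exists (D *m mask_mx T); split=> [l lT|z /submxP[w ->]].
    by rewrite mul_mask (negbTE lT) mulr0.
  have -> : (w *m V) 0 i = (w *m col i V) 0 0 by rewrite colE mulmxA -colE [RHS]mxE.
  by rewrite -[col i V]trmxK VD !trmx_mul !trmxK tr_mask !mulmxA.
move: nsub; rewrite submxE => /rV0Pn[j]; set a := (_ *m _) 0 j => an0.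
exists (a^-1 *: ((col j (cokermx VT^T))^T *m V)); split.
- by rewrite scalemx_sub // submxMl.
- rewrite mxE; suff -> : ((col j (cokermx VT^T))^T *m V) 0 i = a by rewrite mulVf.
  by rewrite /a !mxE; apply: eq_bigr => k _; rewrite !mxE mulrC.
- move=> l lT; rewrite mxE; suff -> : ((col j (cokermx VT^T))^T *m V) 0 l = 0.
    by rewrite mulr0.
  have : (col j (VT^T *m cokermx VT^T))^T = 0 by rewrite mulmx_coker col0 trmx0.
  by rewrite colE -mulmxA -colE trmx_mul trmxK /VT mulmxA => /mul_mask_eq0->.
Qed.

End Masks.

Section NonedgeMatrices.
Variables (R : realFieldType) (n : nat) (e : rel 'I_n).
Hypotheses (esym : forall i j, e i j = e j i) (eirr : forall i, ~~ e i i).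

Definition nonedge_mx (Z : 'M[R]_n) :=
  Z^T = Z /\ forall i j, (i == j) || e i j -> Z i j = 0.

Definition semidefinite_witness d (V : 'M[R]_(d, n)) :=
  exists Z, [/\ nonedge_mx Z,
    forall z : 'rV_n, (z <= V)%MS -> 0 <= bform Z z z
    & exists2 z : 'rV_n, (z <= V)%MS & bform Z z z != 0].

(** The matrix [c^T *m c' + c'^T *m c] gives twice the product of the two linear forms. This is
    twice a square on the row space because the forms agree there, and the separated supports make
    the matrix a nonedge matrix. *)
Lemma square_witness d (V : 'M[R]_(d, n)) (c c' : 'rV[R]_n) :
  (forall i j, c 0 i != 0 -> c' 0 j != 0 -> ~~ ((i == j) || e i j)) ->
  (forall z : 'rV_n, (z <= V)%MS -> (z *m c^T) 0 0 = (z *m c'^T) 0 0) ->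
  (exists2 z : 'rV_n, (z <= V)%MS & (z *m c^T) 0 0 != 0) ->
  semidefinite_witness V.
Proof.
move=> sep eqc [z0 z0V cn0].
have E z : (z <= V)%MS ->
    bform (c^T *m c' + c'^T *m c) z z = 2 * (z *m c^T) 0 0 ^+ 2.
  move=> zV; rewrite bformDm /bform !mulmxA.
  have P (x y : 'rV[R]_n) :
      (z *m x^T *m y *m z^T) 0 0 = (z *m x^T) 0 0 * (z *m y^T) 0 0.
    rewrite -mulmxA mxE big_ord1; congr (_ * _).
    by rewrite -[y *m z^T]trmxK mxE trmx_mul trmxK.
  by rewrite !P -eqc //; ring.
exists (c^T *m c' + c'^T *m c); split.
- split; first by rewrite linearD /= !trmx_mul !trmxK addrC.
  move=> i j ij; rewrite !mxE !big_ord1 !mxE.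
  have ji : (j == i) || e j i by rewrite eq_sym esym.
  have [ci|ci] := eqVneq (c 0 i) 0; have [cj|cj] := eqVneq (c 0 j) 0;
    rewrite ?ci ?cj ?mul0r ?mulr0 ?addr0 ?add0r //.
  + have [->|c'i] := eqVneq (c' 0 i) 0; first by rewrite mul0r.
    by have := sep _ _ cj c'i; rewrite ji.
  + have [->|c'j] := eqVneq (c' 0 j) 0; first by rewrite mulr0.
    by have := sep _ _ ci c'j; rewrite ij.
  + have [->|c'j] := eqVneq (c' 0 j) 0; last by have := sep _ _ ci c'j; rewrite ij.
    have [->|c'i] := eqVneq (c' 0 i) 0; last by have := sep _ _ cj c'i; rewrite ji.
    by rewrite mul0r mulr0 addr0.
- by move=> z zV; rewrite E // mulr_ge0 // sqr_ge0.
- by exists z0 => //; rewrite E // mulf_neq0 ?expf_neq0 ?pnatr_eq0.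
Qed.

Definition nonedge_definite d (V : 'M[R]_(d, n)) :=
  exists2 Z, nonedge_mx Z
    & forall z : 'rV_n, (z <= V)%MS -> z != 0 -> 0 < bform Z z z.

Definition clique_free d (V : 'M[R]_(d, n)) :=
  forall z : 'rV_n, (z <= V)%MS -> clique e [set i | z 0 i != 0] -> z = 0.

Lemma nonedge_mxD (Y Z : 'M[R]_n) a :
  nonedge_mx Y -> nonedge_mx Z -> nonedge_mx (Y + a *: Z).
Proof.
move=> [sY Y0] [sZ Z0]; split; first by rewrite linearD linearZ /= sY sZ.
by move=> i j ij; rewrite !mxE Y0 // Z0 // mulr0 addr0.
Qed.

Lemma tr_conj_mx d1 d2 (V : 'M[R]_(d1, d2)) (M : 'M[R]_d2) :
  M^T = M -> (V *m M *m V^T)^T = V *m M *m V^T.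
Proof. by move=> sM; rewrite !trmx_mul trmxK sM mulmxA. Qed.

(* The rows [W] below span the radical of [Z1] on the row space of [V]. *)
Lemma witness_definite d (V : 'M[R]_(d, n)) :
  row_free V -> clique_free V -> semidefinite_witness V ->
  (forall d' (W : 'M[R]_(d', n)), (d' < d)%N -> row_free W -> clique_free W ->
     nonedge_definite W) ->
  nonedge_definite V.
Proof.
move=> fV cV [Z1 [N1 pos1 [z1 z1V z1n]]] IH.
pose P1 := V *m Z1 *m V^T; have sP1 : P1^T = P1 by apply: tr_conj_mx; case: N1.
pose W := row_base (kermx P1 *m V).
have WV : (W <= V)%MS by rewrite eq_row_base submxMl.
have Wd : (\rank (kermx P1 *m V) < d)%N.
  rewrite mxrankMfree // ltn_neqAle rank_leq_row andbT.
  apply: contra z1n => /eqP kf.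
  have : (1%:M <= kermx P1)%MS by rewrite sub1mx /row_full kf.
  move/sub_kermxP; rewrite mul1mx => P10.
  have /submxP[w ->] := z1V.
  by rewrite -bform_conj -/P1 P10 /bform mulmx0 mul0mx mxE.
have [|Z0 N0 pos0] := IH _ W Wd (row_base_free _).
  by move=> z zW; apply: cV; exact: submx_trans zW WV.
pose P0 := V *m Z0 *m V^T; have sP0 : P0^T = P0 by apply: tr_conj_mx; case: N0.
have [y|y yP yn|t t0 post] := definite_add_multiple sP0 sP1.
- by rewrite bform_conj; apply: pos1; rewrite submxMl.
- rewrite bform_conj; apply: pos0; last by rewrite mulmx_free_eq0.
  rewrite eq_row_base submxMr //; exact/sub_kermxP.
exists (Z0 + t *: Z1); first exact: nonedge_mxD.
move=> z /submxP[w ->]; rewrite mulmx_free_eq0 // => wn0.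
rewrite -bform_conj mulmxDr mulmxDl -scalemxAr -scalemxAl; exact: post.
Qed.

(** Restriction to [J] sends the vectors [h] to the standard basis, so it maps the row space onto a
    space of dimension [#|J|]. *)
Lemma card_free_coordinates d (V : 'M[R]_(d, n)) (J : {set 'I_n}) :
  (forall j, j \in J -> exists h : 'rV[R]_n, [/\ (h <= V)%MS, h 0 j = 1
     & forall l, l \in J -> l != j -> h 0 l = 0]) ->
  (#|J| <= d)%N.
Proof.
move=> hJ; pose S : 'M[R]_(n, #|J|) := \matrix_(i, j) (i == enum_val j)%:R.
have zS (z : 'rV[R]_n) j : (z *m S) 0 j = z 0 (enum_val j).
  rewrite mxE (bigD1 (enum_val j)) //= mxE eqxx mulr1 big1 ?addr0 // => i ni.
  by rewrite mxE (negbTE ni) mulr0.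
have : (1%:M <= V *m S)%MS.
  apply/row_subP => j; have [h [hV hj h0]] := hJ _ (enum_valP j).
  have -> : row j 1%:M = h *m S; last exact: submxMr.
  apply/rowP => k; rewrite zS !mxE; have [<-|jk] := eqVneq j k; first by rewrite hj.
  by rewrite h0 ?enum_valP // (inj_eq enum_val_inj) eq_sym.
by rewrite sub1mx => /eqP <-; exact: rank_leq_row.
Qed.

End NonedgeMatrices.

(** * Linear dependence of coordinates and connected components *)

Section Components.
Variables (R : realFieldType) (n : nat) (e : rel 'I_n).
Hypotheses (esym : forall i j, e i j = e j i) (eirr : forall i, ~~ e i i).

Lemma mul_tr_delta (z : 'rV[R]_n) i : (z *m (delta_mx 0 i : 'rV_n)^T) 0 0 = z 0 i.
Proof. by rewrite trmx_delta -colE mxE. Qed.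

Definition component (I : {set 'I_n}) i : {set 'I_n} :=
  [set j in I | connect (within e I) i j].

(** A vertex of [K] with a neighbour in [K] belongs to it too. *)
Definition open_nbhd (K : {set 'I_n}) : {set 'I_n} :=
  [set y | [exists j in K, e y j]].

(** If coordinate [i] depends on the others listed, moving the terms from [K] to the left gives one
    linear form written both with coordinates in [K] and with coordinates away from [K] and its
    neighbours, so its square is the witness. *)
Lemma component_witness d (V : 'M[R]_(d, n)) (I : {set 'I_n}) i :
  i \in I ->
  (exists h : 'rV[R]_n, [/\ (h <= V)%MS, h 0 i = 1
     & forall l, l \in I :\ i -> h 0 l = 0]) ->
  let K := component I i in
  semidefinite_witness e V \/
  exists g : 'rV[R]_n, [/\ (g <= V)%MS, g 0 i = 1
     & forall l, l \in K :\ i :|: ~: (K :|: open_nbhd K) -> g 0 l = 0].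
Proof.
move=> iI [h [hV hi h0]] K; set N := open_nbhd K.
have [[c [cT cE]]|] := coordinate_alternative V i (K :\ i :|: ~: (K :|: N));
  [left | by right].
have iK : i \in K by rewrite inE iI connect0.
pose c1 := c *m mask_mx R (K :\ i); pose c2 := c *m mask_mx R (~: (K :|: N)).
have cD : c = c1 + c2.
  apply/rowP => l; rewrite [RHS]mxE !mul_mask.
  have := cT l; rewrite !(in_setU, in_setC, in_setD1).
  case: (l \in K); case: (l \in N); case: (l == i) => //= h';
    by rewrite ?mulr1 ?mulr0 ?addr0 ?add0r // h'.
apply: (@square_witness R n e esym _ _ (delta_mx 0 i - c1) c2).
- move=> p q p0 q0.
  have qN : q \notin K :|: N.
    by move: q0; rewrite mul_mask inE; apply: contraNN => ->; rewrite mulr0.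
  have pK : p \in K.
    apply: contraNT p0 => pK; rewrite mxE [(- c1) _ _]mxE mul_mask in_setD1.
    rewrite (negbTE pK) andbF mulr0 subr0 mxE /=.
    by have [pi|] := eqVneq p i; [rewrite pi iK in pK|].
  rewrite inE negb_or in qN; case/andP: qN => qK qN.
  apply: contra qN => /orP[/eqP pq|pq]; first by rewrite -pq pK in qK.
  by rewrite inE; apply/existsP; exists p; rewrite pK esym.
- move=> z zV; rewrite linearB /= mulmxBr [LHS]mxE mul_tr_delta mxE cE // cD.
  by rewrite linearD /= mulmxDr mxE addrC addKr.
- exists h => //; rewrite linearB /= mulmxBr mxE mul_tr_delta hi mxE.
  suff -> : (h *m c1^T) 0 0 = 0 by rewrite subr0 oner_neq0.
  rewrite mxE big1 // => l _; rewrite mxE mul_mask.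
  have [lK|] := boolP (l \in _); last by rewrite mulr0 mulr0.
  by rewrite h0 ?mul0r //; move: lK; rewrite !inE => /and3P[-> ->].
Qed.

Lemma mask_row_eq0 (T : {set 'I_n}) (z : 'rV[R]_n) :
  z *m mask_mx R T = 0 <-> forall j, j \in T -> z 0 j = 0.
Proof.
rewrite mul_mask_eq0; split=> [z0 j|z0 i j]; first exact: z0.
by rewrite (ord1 i); exact: z0.
Qed.

(** A minimal subset of [X] that determines the coordinates in [X] is independent: a coordinate
    depending on the rest could be dropped. *)
Lemma exists_coordinate_basis d (V : 'M[R]_(d, n)) (X : {set 'I_n}) :
  exists I : {set 'I_n}, [/\ I \subset X,
    forall z : 'rV_n, (z <= V)%MS -> (forall i, i \in I -> z 0 i = 0) ->
      forall i, i \in X -> z 0 i = 0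
    & forall i, i \in I -> exists h : 'rV[R]_n, [/\ (h <= V)%MS, h 0 i = 1
       & forall l, l \in I :\ i -> h 0 l = 0]].
Proof.
pose P (I : {set 'I_n}) :=
  (I \subset X) && (kermx (V *m mask_mx R I) *m (V *m mask_mx R X) == 0).
have PP (I : {set 'I_n}) : reflect (I \subset X /\
    forall z : 'rV_n, (z <= V)%MS -> (forall i, i \in I -> z 0 i = 0) ->
      forall i, i \in X -> z 0 i = 0) (P I).
  apply: (iffP andP) => -[IX H]; split=> //.
    move=> _ /submxP[w ->] /mask_row_eq0; rewrite -mulmxA => /sub_kermxP/submxP[w' ->].
    by apply/mask_row_eq0; rewrite -(mulmxA _ V) -(mulmxA w') (eqP H) mulmx0.
  apply/eqP/row_matrixP => k; rewrite row0 row_mul mulmxA; apply/mask_row_eq0.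
  apply: H; first by rewrite submxMl.
  by apply/mask_row_eq0; rewrite -mulmxA; apply/sub_kermxP/row_sub.
have [|I /minsetP[/PP[IX IP] Imin] _] := @minset_exists _ P X.
  by apply/PP.
exists I; split=> // i iI.
have [[c [cI cE]]|] := coordinate_alternative V i (I :\ i); last by [].
suff /Imin/(_ (subD1set I i)) II : P (I :\ i) by move: iI; rewrite -II setD11.
apply/PP; split; first exact: subset_trans (subD1set I i) IX.
move=> z zV z0; apply: IP => // j jI.
have [->|ji] := eqVneq j i; last by apply: z0; rewrite in_setD1 ji.
rewrite cE // mxE big1 // => l _; rewrite [c^T _ _]mxE.
by have [/z0->|/cI->] := boolP (l \in I :\ i); rewrite ?mul0r ?mulr0.
Qed.

End Components.

(** * Elimination of coordinates, and the induction on the dimension *)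

Section Elimination.
Variables (R : realFieldType) (n : nat) (e : rel 'I_n).
Hypotheses (esym : forall i j, e i j = e j i) (eirr : forall i, ~~ e i i).

Lemma connect_within_sym (I : {set 'I_n}) : connect_sym (within e I).
Proof.
apply: sym_connect_sym => x y; rewrite /within /= esym.
by case: (x \in I); case: (y \in I).
Qed.

(* On a row space containing the [g p], [z *m elimination I X g] is
   [z - \sum_(p in I) z 0 p *: g p] as soon as the latter vanishes on [X]; the
   columns in [X] are set to zero so that the conjugate of a nonedge matrix is a
   nonedge matrix entrywise, and not only on that row space. *)
Definition elimination (I X : {set 'I_n}) (g : 'I_n -> 'rV[R]_n) : 'M[R]_n :=
  \matrix_(p, a) ((a \notin X)%:R * ((p == a)%:R - (p \in I)%:R * g p 0 a)).

Lemma eliminationE (I X : {set 'I_n}) (g : 'I_n -> 'rV[R]_n) (z : 'rV[R]_n) a :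
  (z *m elimination I X g) 0 a =
  (a \notin X)%:R * (z - \sum_(p in I) z 0 p *: g p) 0 a.
Proof.
rewrite !mxE summxE.
under eq_bigr => p _ do rewrite mxE mulrCA.
rewrite -mulr_sumr; congr (_ * _).
under eq_bigr => p _ do rewrite mulrBr.
rewrite sumrB; congr (_ - _).
  rewrite (bigD1 a) //= eqxx mulr1 big1 ?addr0 // => p pa.
  by rewrite (negbTE pa) mulr0.
rewrite [RHS]big_mkcond; apply: eq_bigr => p _.
by case: ifP => _; rewrite ?mul0r ?mulr0 // mul1r mxE.
Qed.

(** A nonzero term of the entry [(p, q)] needs nonadjacent neighbours [a], [b] of [v], reached from
    [p] and [q]. If [p] and [q] are equal or adjacent, then [a] and [b] attach to one component of
    [I], which is excluded, or are [p] and [q] themselves. *)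
Lemma elimination_nonedge (I X : {set 'I_n}) v (g : 'I_n -> 'rV[R]_n) Z :
  X = [set y | (y != v) && ~~ e v y] -> I \subset X ->
  (forall p, p \in I -> forall l,
     l \in component e I p :\ p :|:
       ~: (component e I p :|: open_nbhd e (component e I p)) -> g p 0 l = 0) ->
  (forall a b i j, i \in I -> connect (within e I) i j -> e v a -> e v b ->
     a != b -> ~~ e a b -> e a i -> e b j -> False) ->
  nonedge_mx e Z ->
  nonedge_mx e (elimination I X g *m Z *m (elimination I X g)^T).
Proof.
move=> XE /subsetP IX gT nocyc [sZ Z0].
set Q := elimination I X g.
split; first exact: tr_conj_mx.
move=> p q pq.
have inX y : y \notin X -> y = v \/ e v y.
  by rewrite XE inE negb_and !negbK => /orP[/eqP|]; [left|right].
have attach a r : a \notin X -> r \in I -> g r 0 a != 0 ->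
    exists j, [/\ j \in I, connect (within e I) r j & e a j].
  move=> aX rI; have aI : a \notin I by apply: contra aX => /IX.
  have aK : a \notin component e I r by rewrite inE (negbTE aI).
  have [aN _|aN] := boolP (a \in open_nbhd e (component e I r)); last first.
    by rewrite gT ?eqxx // inE in_setC in_setU (negbTE aK) (negbTE aN) orbT.
  move: aN; rewrite inE => /existsP[j]; rewrite inE => /andP[/andP[jI cj] aj].
  by exists j.
have Qn0 r a : Q r a != 0 -> a \notin X /\ ((r == a) || (r \in I) && (g r 0 a != 0)).
  rewrite mxE; case: (a \notin X); last by rewrite mul0r eqxx.
  rewrite mul1r; case: (r == a); first by [].
  case: (r \in I) => /=; last by rewrite mul0r subr0 eqxx.
  by rewrite mul1r sub0r oppr_eq0.
rewrite -[X in X = 0]/((Q *m Z *m Q^T) p q).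
have -> : (Q *m Z *m Q^T) p q = \sum_a \sum_b Q p a * Z a b * Q q b.
  rewrite mxE exchange_big /=; apply: eq_bigr => b _; rewrite !mxE mulr_suml.
  by apply: eq_bigr => a _.
apply: big1 => a _; apply: big1 => b _; apply/eqP; apply: contraT.
rewrite !mulf_eq0 !negb_or => /andP[/andP[/Qn0[aX pa] Zab] /Qn0[bX qb]].
have [ab nab] : a != b /\ ~~ e a b.
  by apply/andP; rewrite -negb_or; apply: contra Zab => /Z0->.
(* Outside [X] there are only [v] and its neighbours, so neither of the nonadjacent [a] and [b] is
   [v]. *)
have va : e v a.
  have [av|//] := inX _ aX; have [bv|vb] := inX _ bX.
    by rewrite av bv eqxx in ab.
  by rewrite av vb in nab.
have vb : e v b.
  by have [bv|//] := inX _ bX; rewrite bv esym va in nab.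
have conn_sym := connect_within_sym I.
have step r s : r \in I -> s \in I -> (r == s) || e r s -> connect (within e I) r s.
  by move=> rI sI /predU1P[->|rs]; [exact: connect0 | apply: connect1; apply/and3P].
exfalso.
case/orP: pa => [/eqP pa|/andP[pI gpa]]; case/orP: qb => [/eqP qb|/andP[qI gqb]].
- by move: pq; rewrite pa qb (negbTE ab) (negbTE nab).
- have [j [jI cj bj]] := attach _ _ bX qI gqb.
  have aq : e a q.
    by case/orP: pq; rewrite pa // => /eqP aq; rewrite aq IX in aX.
  exact: (nocyc a b q j).
- have [j [jI cj aj]] := attach _ _ aX pI gpa.
  have bp : e b p.
    by case/orP: pq; rewrite qb ?(esym p) // => /eqP bp; rewrite -bp IX in bX.
  by apply: (nocyc b a p j) => //; [rewrite eq_sym|rewrite esym].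
- have [j [jI cj aj]] := attach _ _ aX pI gpa.
  have [j' [j'I cj' bj']] := attach _ _ bX qI gqb.
  apply: (nocyc a b j j') => //.
  apply: connect_trans cj'; apply: connect_trans (step _ _ pI qI pq).
  by rewrite conn_sym.
Qed.

Lemma nonadjacent_witness d (V : 'M[R]_(d, n)) v x :
  clique_free e V ->
  (forall k, (4 <= k <= d + 2)%N -> ~ has_induced_cycle k e) ->
  (forall d' (W : 'M[R]_(d', n)), (d' < d)%N -> row_free W -> clique_free e W ->
     nonedge_definite e W) ->
  v != x -> ~~ e v x ->
  (exists2 z : 'rV_n, (z <= V)%MS & z 0 v != 0) ->
  (exists2 z : 'rV_n, (z <= V)%MS & z 0 x != 0) ->
  semidefinite_witness e V.
Proof.
move=> cV nocyc IH vx nvx [zv zvV zvn] [zx zxV zxn].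
pose X := [set y | (y != v) && ~~ e v y].
have xX : x \in X by rewrite inE eq_sym vx.
(* If the coordinate at [v] is a combination of those in [X], its square is the witness. Otherwise
   [t] separates it from [X]. *)
have [[c [cX cE]]|[t [tV tv tX]]] := coordinate_alternative V v X.
  apply: (@square_witness R n e esym _ _ (delta_mx 0 v) c).
  - move=> i j; rewrite mxE /=; have [-> _|_] := eqVneq i v; last by rewrite eqxx.
    have [|/cX->] := boolP (j \in X); last by rewrite eqxx.
    by rewrite inE eq_sym negb_or.
  - by move=> z zV; rewrite mul_tr_delta cE.
  - by exists zv => //; rewrite mul_tr_delta.
have [I [IX Izero hI]] := exists_coordinate_basis V X.
have IXP := subsetP IX.
(* [t] adds [v] to the independent coordinates in [I], which gives the strict bound. *)
have Id : (#|I| + 1 <= d)%N.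
  have -> : (#|I| + 1)%N = #|v |: I|.
    by rewrite cardsU1 addnC; case: (boolP (v \in I)) => // /IXP; rewrite inE eqxx.
  apply: (@card_free_coordinates _ _ _ V) => j; rewrite in_setU1 => /predU1P[->|jI].
    exists t; split=> // l; rewrite in_setU1 => /predU1P[->|/IXP/tX//].
    by rewrite eqxx.
  have [h [hV hj h0]] := hI _ jI.
  exists (h - h 0 v *: t); split.
  - by rewrite addmx_sub // -scaleNr scalemx_sub.
  - by rewrite !mxE hj (tX j (IXP _ jI)) mulr0 subr0.
  - move=> l; rewrite in_setU1 => /predU1P[-> _|lI lj].
      by rewrite !mxE tv mulr1 subrr.
    have h0l : h 0 l = 0 by rewrite h0 // in_setD1 lj.
    by rewrite !mxE h0l (tX l (IXP _ lI)) mulr0 subr0.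
have cyc a b i j : i \in I -> connect (within e I) i j -> e v a -> e v b ->
    a != b -> ~~ e a b -> e a i -> e b j -> False.
  move=> iI cij va vb ab nab ai bj.
  have [y yI|k [k4 kI ck]] :=
    connect_induced_cycle esym eirr (I := I) _ iI cij va vb ab nab ai bj.
    by have := IXP _ yI; rewrite inE => /andP[].
  apply: (nocyc k) ck; rewrite k4 (leq_trans kI) //=.
  by move: #|I| Id; clear => c; lia.
pose T i := component e I i :\ i :|:
   ~: (component e I i :|: open_nbhd e (component e I i)).
pose ok i (g : 'rV[R]_n) :=
  (i \in I) ==> [&& (g <= V)%MS, g 0 i == 1 & [forall l in T i, g 0 l == 0]].
have : forall i, exists g, semidefinite_witness e V \/ ok i g.
  move=> i; have [iI|iI] := boolP (i \in I); last first.
    by exists 0; right; rewrite /ok (negbTE iI).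
  have [|[g [gV gi g0]]] := component_witness esym iI (hI _ iI).
    by exists 0; left.
  exists g; right; rewrite /ok iI gV gi eqxx /=.
  by apply/forall_inP => l lT; apply/eqP/g0.
move/fin_all_exists => [g gP].
have [/forallP gok|/forallPn[i nok]] := boolP [forall i, ok i (g i)]; last first.
  by case: (gP i) => // oki; rewrite oki in nok.
have {gP}gV i : i \in I -> (g i <= V)%MS.
  by move=> iI; have := gok i; rewrite /ok iI => /and3P[].
have gi i : i \in I -> g i 0 i = 1.
  by move=> iI; have := gok i; rewrite /ok iI => /and3P[_ /eqP].
have gT i : i \in I -> forall l, l \in T i -> g i 0 l = 0.
  move=> iI l lT; have := gok i; rewrite /ok iI => /and3P[_ _ /forall_inP/(_ _ lT)].
  by move/eqP.
(* A vertex of [I] adjacent to a component of [I] lies in it, so the constraint on [g i] covers all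
   of [I] except [i]. *)
have gI i j : i \in I -> j \in I -> i != j -> g i 0 j = 0.
  move=> iI jI ij; apply: gT => //; rewrite in_setU in_setC in_setU in_setD1 eq_sym ij.
  have [//|jK] /= := boolP (j \in component e I i).
  rewrite inE; apply/existsPn => k; apply: contra jK => /andP[].
  rewrite !inE jI => /andP[kI ck] jk.
  by apply: connect_trans ck _; apply: connect1; apply/and3P; split; rewrite // esym.
pose pr (z : 'rV[R]_n) := z - \sum_(p in I) z 0 p *: g p.
have prV z : (z <= V)%MS -> (pr z <= V)%MS.
  move=> zV; rewrite addmx_sub // eqmx_opp summx_sub // => p pI.
  by rewrite scalemx_sub // gV.
have prX z : (z <= V)%MS -> forall i, i \in X -> pr z 0 i = 0.
  move=> zV; apply: Izero; first exact: prV.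
  move=> i iI; rewrite mxE [X in _ + X]mxE summxE (bigD1 i) //= mxE gi // mulr1.
  rewrite big1 ?addr0 ?subrr // => j /andP[jI ji].
  by rewrite mxE gI // mulr0.
pose Q := elimination I X g.
have QE z : (z <= V)%MS -> z *m Q = pr z.
  move=> zV; apply/rowP => a; rewrite eliminationE -/(pr z).
  have [aX|aX] := boolP (a \in X); last by rewrite mul1r.
  by rewrite mul0r prX.
have VQV : (V *m Q <= V)%MS.
  apply/row_subP => i; rewrite row_mul QE ?row_sub //; apply: prV; exact: row_sub.
pose W := row_base (V *m Q).
(* The image vanishes on [X], while [zx] does not vanish at [x]. *)
have Wd : (\rank (V *m Q) < d)%N.
  rewrite ltn_neqAle rank_leq_row andbT; apply: contra zxn => /eqP rd.
  have VQ : (V <= V *m Q)%MS.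
    rewrite -(geq_leqif (mxrank_leqif_sup VQV)) rd; exact: rank_leq_row.
  have /submxP[w ->] := submx_trans zxV VQ.
  by rewrite mulmxA QE ?submxMl // prX // submxMl.
have [|Z' N' pos'] := IH _ W Wd (row_base_free _).
  move=> z zW; apply: cV; apply: submx_trans zW _; by rewrite eq_row_base.
have pQ z : (z <= V)%MS -> (z *m Q <= W)%MS.
  by move=> zV; rewrite eq_row_base submxMr.
exists (Q *m Z' *m Q^T); split.
- exact: (elimination_nonedge (erefl X) IX gT cyc N').
- move=> z zV; rewrite bform_conj; have [->|zn] := eqVneq (z *m Q) 0.
    by rewrite bform0l.
  by apply/ltW/pos' => //; exact: pQ.
(* Since [t] vanishes on [X], the elimination fixes it, and the form is positive there. *)
- exists t => //; rewrite bform_conj; apply/lt0r_neq0/pos'; first exact: pQ.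
  rewrite QE // /pr big1 ?subr0 => [|p pI]; last by rewrite tX ?scale0r // IXP.
  by apply/eqP => t0; move/eqP: tv; rewrite t0 mxE eq_sym oner_eq0.
Qed.

Lemma clique_free_definite d (V : 'M[R]_(d, n)) :
  row_free V -> clique_free e V ->
  (forall k, (4 <= k <= d + 2)%N -> ~ has_induced_cycle k e) ->
  nonedge_definite e V.
Proof.
elim/ltn_ind: d V => d IHd V fV cV nocyc.
have IH d' (W : 'M[R]_(d', n)) : (d' < d)%N -> row_free W -> clique_free e W ->
    nonedge_definite e W.
  move=> d'd fW cW; apply: IHd => // k kd; apply: nocyc; lia.
pose bad (p : 'I_n * 'I_n) :=
  [&& p.1 != p.2, ~~ e p.1 p.2, col p.1 V != 0 & col p.2 V != 0].
have coln i : col i V != 0 -> exists2 z : 'rV_n, (z <= V)%MS & z 0 i != 0.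
  move=> /cV0Pn[k]; rewrite mxE => Vki; exists (row k V); first exact: row_sub.
  by rewrite mxE.
have [/existsP[[v x] /and4P[/= vx nvx /coln vn /coln xn]]|/existsPn good] :=
  boolP [exists p, bad p].
  apply: witness_definite => //; exact: (nonadjacent_witness cV nocyc IH vx nvx).
(* Now the support of every vector is a clique, so the row space is zero. *)
exists 0; first by split; [rewrite trmx0 | move=> i j _; rewrite mxE].
move=> z zV /eqP[]; apply: cV => // i j; rewrite !inE => zi zj ij.
have nz k : z 0 k != 0 -> col k V != 0.
  apply: contraNN => /eqP Vk; have /submxP[w ->] := zV.
  have -> : (w *m V) 0 k = (w *m col k V) 0 0 by rewrite colE mulmxA -colE [RHS]mxE.
  by rewrite Vk mulmx0 mxE.
by have := good (i, j); rewrite /bad /= ij !nz // !andbT negbK.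
Qed.

End Elimination.

(** * Completions *)

Section Glue.
Variables (R : realFieldType) (n : nat).
Local Notation D := (mask_mx R).

Lemma mask_mxI (S T : {set 'I_n}) : D S *m D T = D (S :&: T).
Proof.
apply/matrixP => i j; rewrite mask_mul !mxE !mulrb inE.
by case: (i == j); case: (i \in S); case: (i \in T) => //=;
  rewrite ?mulr0n ?mulr1n ?mul1r ?mul0r ?mulr0.
Qed.

Lemma mask_mx0 : D (set0 : {set 'I_n}) = 0.
Proof. by apply/matrixP => i j; rewrite !mxE inE mul0rn. Qed.

Lemma mask_row_id (S : {set 'I_n}) (z : 'rV[R]_n) :
  z *m D S = z <-> forall i, i \notin S -> z 0 i = 0.
Proof.
split=> [/rowP zS i iS|zS].
  by have := zS i; rewrite mul_mask (negbTE iS) mulr0.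
apply/rowP => i; rewrite mul_mask.
by have [_|/zS->] := boolP (i \in S); rewrite ?mulr1 ?mul0r.
Qed.

Lemma mask_eq_entry (S T : {set 'I_n}) (X Y : 'M[R]_n) i j :
  D S *m X *m D T = D S *m Y *m D T -> i \in S -> j \in T -> X i j = Y i j.
Proof.
move=> /matrixP/(_ i j) E iS jT; move: E.
by rewrite !mul_mask !mask_mul iS jT !mul1r !mulr1.
Qed.

Definition definite_on (W : {set 'I_n}) (B : 'M[R]_n) :=
  forall z : 'rV_n, z *m D W = z -> z != 0 -> 0 < bform B z z.

Lemma definite_on_ge0 W B (z : 'rV_n) :
  definite_on W B -> z *m D W = z -> 0 <= bform B z z.
Proof.
move=> pB zW; have [->|zn] := eqVneq z 0; first by rewrite bform0l.
exact/ltW/pB.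
Qed.

(** [H] is the orthogonal projection for [B] onto the vectors supported on [S]. It is found by
    inverting the compression of [B] to [S], with the identity added off [S]. *)
Lemma orthogonalizer (B : 'M[R]_n) (S : {set 'I_n}) :
  definite_on S B -> exists H : 'M[R]_n, H *m D S = H /\ H *m B *m D S = B *m D S.
Proof.
move=> pB; pose M := D S *m B *m D S + D (~: S).
have DD : D S *m D S = D S by rewrite mask_mxI setIid.
have uM : M \in unitmx.
  rewrite -row_free_unit -kermx_eq0; apply/eqP/row_matrixP => i.
  set z := row i _; rewrite row0.
  have zM : z *m M = 0 by apply/sub_kermxP/row_sub.
  have zS : z *m D (~: S) = 0.
    have : z *m M *m D (~: S) = 0 by rewrite zM mul0mx.
    rewrite /M mulmxDr mulmxDl -!mulmxA !mask_mxI setICr setIid.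
    by rewrite mask_mx0 !mulmx0 add0r.
  have zE : z *m D S = z.
    apply/mask_row_id => j jS; apply: (proj1 (mask_row_eq0 _ _) zS).
    by rewrite inE.
  apply/eqP; apply: contraT => zn; have := pB z zE zn.
  have : bform M z z = 0 by rewrite /bform zM mul0mx mxE.
  rewrite /M bformDm [bform (D (~: S)) _ _]/bform zS mul0mx mxE addr0.
  rewrite -{2}(tr_mask _ S) bform_conj zE => ->; by rewrite ltxx.
exists (B *m D S *m invmx M *m D S); split; first by rewrite -mulmxA DD.
have MD : D S *m B *m D S = M *m D S.
  by rewrite /M mulmxDl -!mulmxA !mask_mxI setIid (setIC (~: S)) setICr mask_mx0 addr0.
rewrite -(mulmxA _ (D S) B) -(mulmxA _ (D S *m B)) MD !mulmxA.
by rewrite mulmxKV // -mulmxA DD.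
Qed.

(* If [H] is the [B1]-orthogonal projection onto the vectors supported on [S],
   then [z_K + z_W] gets the value of [B1] at [z_K - z_K *m H] plus that of [B2]
   at [z_W + z_K *m H]. *)
Lemma amalgamation (B1 B2 : 'M[R]_n) (K S W : {set 'I_n}) :
  B1^T = B1 -> B2^T = B2 -> S \subset W -> [disjoint K & W] ->
  definite_on (K :|: S) B1 -> definite_on W B2 ->
  (forall i j, i \in S -> j \in S -> B1 i j = B2 i j) ->
  exists B : 'M[R]_n, [/\ B^T = B, definite_on (K :|: W) B,
    forall i j, i \in K -> j \in K :|: S -> B i j = B1 i j
    & forall i j, i \in W -> j \in W -> B i j = B2 i j].
Proof.
move=> s1 s2 SW KW p1 p2 B12.
have KW0 : K :&: W = set0 by apply/eqP; rewrite setI_eq0.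
have KS0 : K :&: S = set0.
  by apply/eqP; rewrite -subset0 -KW0; apply: setIS.
have DKW : D K *m D W = 0 by rewrite mask_mxI KW0 mask_mx0.
have DWK : D W *m D K = 0 by rewrite mask_mxI setIC KW0 mask_mx0.
have DSK : D S *m D K = 0 by rewrite mask_mxI setIC KS0 mask_mx0.
have DSW : D S *m D W = D S by rewrite mask_mxI (setIidPl SW).
have DD (T : {set 'I_n}) : D T *m D T = D T by rewrite mask_mxI setIid.
have [|H [HD HB]] := @orthogonalizer B1 S.
  move=> z zS; apply: p1; apply/mask_row_id => i; rewrite inE negb_or => /andP[_].
  by apply: (proj1 (mask_row_id _ _) zS).
have HtD : D S *m H^T = H^T by rewrite -{1}(tr_mask _ S) -trmx_mul HD.
have DBD : D S *m B1 *m D S = D S *m B2 *m D S.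
  apply/matrixP => i j; rewrite !mul_mask !mask_mul.
  by have [iS|] := boolP (i \in S); have [jS|] := boolP (j \in S);
    rewrite ?mul0r ?mulr0 // B12.
have HBH1 : H *m B1 *m H^T = B1 *m H^T.
  by rewrite -HtD !mulmxA HB.
have HBH2 : H *m B1 *m H^T = H *m B1.
  by rewrite -[RHS]trmxK trmx_mul s1 -HBH1 !trmx_mul trmxK s1 mulmxA.
have HB2H : H *m B2 *m H^T = H *m B1 *m H^T.
  have E (X : 'M_n) : H *m X *m H^T = H *m (D S *m X *m D S) *m H^T.
    by rewrite !mulmxA HD -!mulmxA HtD.
  by rewrite E [RHS]E DBD.
pose P1 := D K *m (1%:M - H); pose P2 := D W + D K *m H.
pose B := P1 *m B1 *m P1^T + P2 *m B2 *m P2^T.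
have conj (T U : {set 'I_n}) : D T *m B *m D U =
    (D T *m P1) *m B1 *m (D U *m P1)^T + (D T *m P2) *m B2 *m (D U *m P2)^T.
  by rewrite /B mulmxDr mulmxDl !trmx_mul !tr_mask !mulmxA.
have KP1 : D K *m P1 = D K *m (1%:M - H) by rewrite /P1 mulmxA DD.
have KP2 : D K *m P2 = D K *m H by rewrite /P2 mulmxDr mulmxA DKW DD add0r.
have SP1 : D S *m P1 = 0 by rewrite /P1 mulmxA DSK mul0mx.
have SP2 : D S *m P2 = D S by rewrite /P2 mulmxDr mulmxA DSW DSK mul0mx addr0.
have WP1 : D W *m P1 = 0 by rewrite /P1 mulmxA DWK mul0mx.
have WP2 : D W *m P2 = D W by rewrite /P2 mulmxDr mulmxA DD DWK mul0mx addr0.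
(* On [K] the two summands recombine to [B1]: the part along [S] is measured by [B2], which agrees
   with [B1] there. *)
have BKK : D K *m B *m D K = D K *m B1 *m D K.
  have E : (1%:M - H) *m B1 *m (1%:M - H)^T + H *m B2 *m H^T = B1.
    rewrite HB2H linearB /= trmx1 mulmxBr mulmx1 !mulmxBl mul1mx.
    set X := H *m B1 *m H^T in HBH1 HBH2 *; rewrite -HBH1 -HBH2.
    by rewrite subrr subr0 subrK.
  rewrite conj KP1 KP2 !trmx_mul !tr_mask -[in RHS]E.
  by rewrite [in RHS](mulmxDr (D K)) [in RHS]mulmxDl !mulmxA.
have BKS : D K *m B *m D S = D K *m B1 *m D S.
  rewrite conj SP1 trmx0 mulmx0 add0r KP2 SP2 tr_mask.
  have HB2S : H *m B2 *m D S = B1 *m D S.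
    transitivity (H *m (D S *m B2 *m D S)); first by rewrite !mulmxA HD.
    by rewrite -DBD !mulmxA HD HB.
  by rewrite -[RHS]mulmxA -HB2S !mulmxA.
have BWW : D W *m B *m D W = D W *m B2 *m D W.
  by rewrite conj WP1 trmx0 mulmx0 add0r WP2 tr_mask.
exists B; split.
- by rewrite /B linearD /= !tr_conj_mx.
- move=> z zE zn; rewrite /B bformDm !bform_conj.
  have suppS (y : 'rV_n) (T U : {set 'I_n}) :
      y *m D T = y -> T \subset U -> y *m D U = y.
    by move=> yT TU; rewrite -yT -mulmxA mask_mxI (setIidPl TU).
  have zP1 : z *m P1 *m D (K :|: S) = z *m P1.
    rewrite mulmxA mulmxBr mulmx1 mulmxBl; congr (_ - _).
      by apply: suppS (subsetUl _ _); rewrite -mulmxA DD.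
    by apply: suppS (subsetUr K S); rewrite -mulmxA HD.
  have zP2 : z *m P2 *m D W = z *m P2.
    rewrite mulmxDr mulmxDl; congr (_ + _); first by rewrite -mulmxA DD.
    by apply: suppS SW; rewrite -!mulmxA HD.
  have q1 := definite_on_ge0 p1 zP1; have q2 := definite_on_ge0 p2 zP2.
  (* If [z] lives on [W], the second summand is [B2] at [z]. Otherwise [z *m P1] is nonzero, as its
     coordinates in [K] are those of [z]. *)
  have [zK|zK] := eqVneq (z *m D K) 0.
    rewrite ltr_wpDl //; apply: p2 => //.
    suff -> : z *m P2 = z by [].
    rewrite /P2 mulmxDr mulmxA zK mul0mx addr0; apply/mask_row_id => i iW.
    have [iK|iK] := boolP (i \in K); first exact: (proj1 (mask_row_eq0 _ _) zK).
    by apply: (proj1 (mask_row_id _ _) zE); rewrite inE negb_or iK.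
  rewrite ltr_pwDl //; apply: p1 => //.
  apply: contraNneq zK => /(congr1 (mulmx^~ (D K))).
  rewrite mul0mx /P1 -HD mulmxBr mulmx1 mulmxBr mulmxBl -!mulmxA DSK DD.
  by rewrite !mulmx0 subr0 => ->.
- move=> i j iK; rewrite inE => /orP[jK|jS].
    exact: mask_eq_entry BKK iK jK.
  exact: mask_eq_entry BKS iK jS.
- by move=> i j; exact: mask_eq_entry BWW.
Qed.

End Glue.

(** * Positive definite completions under condition (a) *)

Section Completion.
Variables (R : realFieldType) (n : nat) (e : rel 'I_n).
Hypotheses (esym : forall i j, e i j = e j i) (eirr : forall i, ~~ e i i).
Variable A : 'M[R]_n.
Hypothesis sA : A^T = A.

Lemma pos_defE d (B : 'M[R]_d) :
  pos_def B <-> B^T = B /\ forall z : 'rV_d, z != 0 -> 0 < bform B z z.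
Proof.
split=> -[sB pB]; split=> // x xn.
  by have := pB x^T; rewrite trmx_eq0 trmxK; apply.
by have := pB x^T; rewrite trmx_eq0 /bform trmxK; apply.
Qed.

Definition selection (S : {set 'I_n}) : 'M[R]_(#|S|, n) :=
  \matrix_(k, i) (i == enum_val k)%:R.

Lemma mul_selection (S : {set 'I_n}) (w : 'rV[R]_#|S|) k :
  (w *m selection S) 0 (enum_val k) = w 0 k.
Proof.
rewrite mxE (bigD1 k) //= mxE eqxx mulr1 big1 ?addr0 // => l lk.
by rewrite mxE (inj_eq enum_val_inj) eq_sym (negbTE lk) mulr0.
Qed.

Lemma selection_mul p (S : {set 'I_n}) (M : 'M[R]_(n, p)) k j :
  (selection S *m M) k j = M (enum_val k) j.
Proof.
rewrite mxE (bigD1 (enum_val k)) //= mxE eqxx mul1r big1 ?addr0 // => l lk.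
by rewrite mxE (negbTE lk) mul0r.
Qed.

Lemma mul_tr_selection p (S : {set 'I_n}) (M : 'M[R]_(p, n)) i k :
  (M *m (selection S)^T) i k = M i (enum_val k).
Proof. by rewrite -[M]trmxK -trmx_mul [LHS]mxE selection_mul !mxE. Qed.

Lemma principal_submxE (B : 'M[R]_n) S :
  principal_submx B S = selection S *m B *m (selection S)^T.
Proof.
by apply/matrixP => i j; rewrite mxE -mulmxA selection_mul mul_tr_selection.
Qed.

Lemma mask_selection (S : {set 'I_n}) (z : 'rV[R]_n) :
  z *m mask_mx R S = z -> z = (\row_k z 0 (enum_val k)) *m selection S.
Proof.
move=> /mask_row_id zS; apply/rowP => i; have [iS|iS] := boolP (i \in S).
  by rewrite -(enum_rankK_in iS iS) mul_selection mxE.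
rewrite zS // mxE big1 // => k _; rewrite mxE [selection _ _ _]mxE.
have [ik|_] := eqVneq i (enum_val k); last by rewrite mulr0.
by rewrite ik enum_valP in iS.
Qed.

Lemma cliques_pd_definite_on S : cliques_pd e A -> clique e S -> definite_on S A.
Proof.
move=> cA /cA/pos_defE[_ pS] z zS zn.
rewrite (mask_selection zS) -bform_conj -principal_submxE; apply: pS.
by apply: contraNneq zn => w0; rewrite (mask_selection zS) w0 mul0mx.
Qed.

Lemma completion_cliques_pd B : completion e A B -> pos_def B -> cliques_pd e A.
Proof.
move=> [sB [Bd Be]] /pos_defE[_ pB] S cS.
have -> : principal_submx A S = principal_submx B S.
  apply/matrixP => i j; rewrite !mxE; have [->|ij] := eqVneq i j; first by rewrite Bd.
  by rewrite Be //; apply: cS; rewrite ?enum_valP // (inj_eq enum_val_inj).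
apply/pos_defE; split; first by rewrite principal_submxE; exact: tr_conj_mx.
move=> w wn; rewrite principal_submxE bform_conj; apply: pB.
apply: contraNneq wn => w0; apply/eqP/rowP => k.
by rewrite -mul_selection w0 !mxE.
Qed.

Lemma completion_add_nonedge B Z :
  completion e A B -> nonedge_mx e Z -> completion e A (B + Z).
Proof.
move=> [sB [Bd Be]] [sZ Z0]; split; first by rewrite /symmetric_mx linearD /= sB sZ.
by split=> [i|i j ij]; rewrite mxE Z0 ?addr0 ?Bd ?Be ?eqxx ?ij ?orbT.
Qed.

Lemma semidef_completion_definite B :
  cliques_pd e A -> completion e A B -> pos_semidef B ->
  (forall k, (4 <= k <= n - \rank B + 2)%N -> ~ has_induced_cycle k e) ->
  exists B', completion e A B' /\ pos_def B'.
Proof.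
move=> cA compB [sB pB] nocyc.
have psd y : 0 <= bform B y y by have := pB y^T; rewrite trmxK.
have [sB' [Bd Be]] := compB.
have [|||Z NZ pZ] := @clique_free_definite R n e esym eirr _ (row_base (kermx B)).
- exact: row_base_free.
- move=> z; rewrite eq_row_base => /sub_kermxP zB cz; apply/eqP; apply: contraT => zn.
  have zS : z *m mask_mx R [set i | z 0 i != 0] = z.
    by apply/mask_row_id => i; rewrite inE negbK => /eqP.
  have := cliques_pd_definite_on cA cz zS zn.
  have -> : bform A z z = bform B z z.
    rewrite !bformE; apply: eq_bigr => i _; apply: eq_bigr => j _.
    have [->|zi] := eqVneq (z 0 i) 0; first by rewrite !mul0r.
    have [->|zj] := eqVneq (z 0 j) 0; first by rewrite !mulr0.
    have [->|ij] := eqVneq i j; first by rewrite Bd.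
    by rewrite Be // cz // inE.
  by rewrite /bform zB mul0mx mxE ltxx.
- by rewrite mxrank_ker.
have [|t t0 pt] := definite_add_multiple (proj1 NZ) sB psd.
  by move=> y yB yn; apply: pZ => //; rewrite eq_row_base; apply/sub_kermxP.
(* Dividing [Z + t *: B] by [t] makes the coefficient of [B] equal to 1, as a completion
   requires. *)
exists (B + t^-1 *: Z); split.
  apply: completion_add_nonedge => //; rewrite -[_ *: _]add0r; apply: nonedge_mxD NZ.
  by split; [rewrite trmx0 | move=> i j _; rewrite mxE].
apply/pos_defE; split; first by rewrite linearD linearZ /= sB (proj1 NZ).
move=> z zn; have -> : B + t^-1 *: Z = t^-1 *: (Z + t *: B).
  by rewrite scalerDr scalerA mulVf ?gt_eqF // scale1r addrC.
by rewrite bformZm mulr_gt0 ?invr_gt0 // pt.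
Qed.

(** Definiteness is asked only on [W], while the completion keeps its full size; this allows
    induction on [#|W|]. *)
Lemma chordal_definite_on (W : {set 'I_n}) :
  chordal e -> cliques_pd e A ->
  exists B, completion e A B /\ definite_on W B.
Proof.
move=> chG cA; elim/ltn_ind: {W}#|W| {-2}W (erefl #|W|) => w IH W Ww.
pose bad (p : 'I_n * 'I_n) :=
  [&& p.1 \in W, p.2 \in W, p.1 != p.2 & ~~ e p.1 p.2].
have [/existsP[[v x] /and4P[/= vW xW vx nvx]]|/existsPn good] :=
  boolP [exists p, bad p]; last first.
  exists A; split; first by split.
  apply: cliques_pd_definite_on => // i j iW jW ij.
  by have := good (i, j); rewrite /bad /= iW jW ij negbK.
(* [S] is the boundary in [W] of the component [K] of [x] among the non-neighbours of [v]; within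
   [W] it separates [v] from [x]. *)
pose X := [set y in W | (y != v) && ~~ e v y].
pose K := component e X x.
pose S := [set y in W | (y \notin K) && (y \in open_nbhd e K)].
have xX : x \in X by rewrite inE xW eq_sym vx.
have KX : K \subset X by apply/subsetP => y; rewrite inE => /andP[].
have XP y : y \in X -> [/\ y \in W, y != v & ~~ e v y].
  by rewrite inE => /andP[-> /andP[-> ->]].
have xK : x \in K by rewrite inE xX connect0.
have KP y : y \in K -> y \in X /\ connect (within e X) x y by rewrite inE => /andP[].
have SP y : y \in S -> [/\ y \in W, y \notin K, e v y & exists2 j, j \in K & e y j].
  rewrite inE => /andP[yW /andP[yK]]; rewrite inE => /existsP[j /andP[jK yj]].
  split=> //; last by exists j.
  have [jX cj] := KP _ jK; have [_ _ nvj] := XP _ jX.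
  apply: contraNT yK => nvy.
  have yX : y \in X.
    rewrite inE yW nvy andbT; apply: contra nvj => /eqP <-; exact: yj.
  by rewrite inE yX (connect_trans cj) // connect1 //; apply/and3P; rewrite esym.
(* All of [S] is adjacent to [v] and attached to [K], so nonadjacent [s], [s'] would close up to a
   chordless cycle. *)
have cS : clique e S.
  move=> s s' /SP[_ _ vs [j jK sj]] /SP[_ _ vs' [j' j'K sj']] ss'.
  apply: contraT => nss'.
  have [jX cj] := KP _ jK; have [j'X cj'] := KP _ j'K.
  have cjj' : connect (within e X) j j'.
    by rewrite (connect_trans _ cj') // (connect_within_sym esym).
  have [y /XP[]//|k [k4 _ ck]] :=
    connect_induced_cycle esym eirr _ jX cjj' vs vs' ss' nss' sj sj'.
  by case: (chG k k4).
pose W2 := W :\: K.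
have SW2 : S \subset W2.
  by apply/subsetP => y /SP[yW yK _ _]; rewrite in_setD yK.
have KW : K \subset W by apply: subset_trans KX _; apply/subsetP => y /XP[].
have KW2 : [disjoint K & W2].
  rewrite -setI_eq0; apply/eqP/setP => y; rewrite in_setI in_setD in_set0.
  by case: (y \in K); rewrite ?andbF.
have [B1 [[s1 [d1 e1]] p1]] : exists B, completion e A B /\ definite_on (K :|: S) B.
  apply: (IH #|K :|: S|) => //; rewrite -Ww; apply: proper_card.
  apply/properP; split.
    by rewrite subUset KW; apply/subsetP => y /SP[].
  exists v => //; rewrite in_setU negb_or; apply/andP; split.
    by apply/negP => /KP[/XP[_]]; rewrite eqxx.
  by apply/negP => /SP[_ _]; rewrite (negbTE (eirr v)).
have [B2 [[s2 [d2 e2]] p2]] : exists B, completion e A B /\ definite_on W2 B.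
  apply: (IH #|W2|) => //; rewrite -Ww; apply: proper_card.
  apply/properP; split; first exact: subsetDl.
  by exists x => //; rewrite in_setD xK.
have B12 i j : i \in S -> j \in S -> B1 i j = B2 i j.
  move=> iS jS; have [->|ij] := eqVneq i j; first by rewrite d1 d2.
  by rewrite e1 ?e2 // cS.
have [B [sB pB BK BW]] := amalgamation s1 s2 SW2 KW2 p1 p2 B12.
have KW2E : K :|: W2 = W.
  apply/setP => i; rewrite in_setU in_setD.
  by have [/(subsetP KW)->|] := boolP (i \in K).
(* An edge from [K] inside [W] ends in [K :|: S], where the entries are those of [B1]. *)
have BKA i j : i \in K -> j \in W -> e i j -> B i j = A i j.
  move=> iK jW ij; rewrite BK ?e1 // in_setU; have [//|jK /=] := boolP (j \in K).
  rewrite inE jW jK inE; apply/existsP; exists i; by rewrite iK esym.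
have Bsym i j : B i j = B j i by rewrite -[in RHS]sB mxE.
(* Resetting the other entries to those of [A] does not affect the form on vectors supported on
   [W]. *)
pose C := \matrix_(i, j) if (i \in W) && (j \in W) then B i j else A i j.
exists C; split; first split; [|split|].
- apply/matrixP => i j; rewrite !mxE andbC Bsym.
  by case: ifP => // _; rewrite -[in RHS]sA mxE.
- move=> i; rewrite mxE; case: ifP => // /andP[iW _].
  have [iK|iK] := boolP (i \in K); first by rewrite BK ?d1 // in_setU iK.
  by rewrite BW ?d2 // in_setD iK.
- move=> i j ij; rewrite mxE; case: ifP => // /andP[iW jW].
  have [iK|iK] := boolP (i \in K); first exact: BKA.
  have [jK|jK] := boolP (j \in K).
    by rewrite Bsym BKA // 1?esym // -[in RHS]sA mxE.
  by rewrite BW ?e2 // in_setD ?iK ?jK.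
- move=> z zW zn; have -> : bform C z z = bform B z z.
    move/mask_row_id: zW => zW; rewrite !bformE.
    apply: eq_bigr => i _; apply: eq_bigr => j _; rewrite mxE.
    have [iW|/zW->] := boolP (i \in W); last by rewrite !mul0r.
    by have [jW|/zW->] := boolP (j \in W); last by rewrite !mulr0.
  by apply: pB => //; rewrite KW2E.
Qed.

End Completion.

Theorem theorem6p7 (R : rcfType) (n : nat) (e : rel 'I_n) (A : 'M[R]_n) :
  simple_graph e -> symmetric_mx A ->
  (forall m : nat, (4 <= m)%N -> has_induced_cycle m e ->
     (forall k : nat, (4 <= k)%N -> (k < m)%N -> ~ has_induced_cycle k e) ->
     ((exists B, completion e A B /\ pos_def B) <->
      (cliques_pd e A /\
       exists B, completion e A B /\ pos_semidef B /\ (n - m + 2 < \rank B)%N)))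
  /\
  (chordal e -> ((exists B, completion e A B /\ pos_def B) <-> cliques_pd e A)).
Proof.
move=> [esym eirr] sA; split=> [m m4 [f [finj _]] nocyc | chG].
  have mn : (m <= n)%N by have := leq_card f finj; rewrite !card_ord.
  split=> [[B [cB pB]]|[cA [B [cB [pB rB]]]]].
    split; first exact: completion_cliques_pd cB pB.
    exists B; split=> //; split.
      case: pB => sB pB; split=> // x; have [->|/pB/ltW//] := eqVneq x 0.
      by rewrite mulmx0 mxE.
    have /pos_defE[_ pB'] := pB.
    (* The full rank [n] exceeds [n - m + 2] because [4 <= m <= n]. *)
    suff /eqP-> : row_free B by lia.
    rewrite -kermx_eq0; apply/eqP/row_matrixP => i; rewrite row0.
    apply/eqP; apply: contraT => /pB'.
    have zB : row i (kermx B) *m B = 0 by apply/sub_kermxP/row_sub.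
    by rewrite /bform zB mul0mx mxE ltxx.
  apply: (semidef_completion_definite esym eirr cA cB pB) => k /andP[k4 kn].
  (* The rank condition says [n - r + 2 < m], so the cycles to be excluded are shorter than the
     shortest one. *)
  have bound r : (r <= n -> n - m + 2 < r -> k <= n - r + 2 -> k < m)%N by lia.
  exact: nocyc k4 (bound _ (rank_leq_row B) rB kn).
split=> [[B [cB pB]]|cA]; first exact: completion_cliques_pd cB pB.
have [B [cB pB]] := chordal_definite_on esym eirr sA setT chG cA.
exists B; split=> //; apply/pos_defE; split; first by case: cB.
by move=> z; apply: pB; apply/mask_row_id => i; rewrite inE.
Qed.
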